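(* Let $n=2$ and $d:=d_1=d_2$. Let $Y\subseteq\mathbb P^{d-1}\times\mathbb P^{d-1}$ be an irreducible subvariety whose prime ideal is $\langle f_1,\dots,f_s\rangle\subseteq R$. Set $$\bar\pi^{(1)}=(\det(G^{(2)}_1),\dots,\det(G^{(2)}_d)),\qquad \bar\pi^{(2)}=(\det(G^{(1)}_1),\dots,\det(G^{(1)}_d)).$$ Then: (1) The Nash locus $\mathcal N(Y)$ is set-theoretically cut out by $$\bigl\langle f_1(\bar\pi^{(1)},\bar\pi^{(2)}),\dots,f_s(\bar\pi^{(1)},\bar\pi^{(2)})\bigr\rangle:\bigl(\langle\bar\pi^{(1)}_1,\dots,\bar\pi^{(1)}_d\rangle\cap\langle\bar\pi^{(2)}_1,\dots,\bar\pi^{(2)}_d\rangle\bigr)^\infty\subseteq S.$$ (2) Those games that admit a totally mixed Nash equilibrium on $Y$ are obtained from the real points of $\mathcal N(Y)$ by imposing the additional semialgebraic conditions $\det(G^{(1)}_i)>0$ and $\det(G^{(2)}_i)>0$ for all $i\in\{1,\dots,d\}$.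
   Context: Varieties are over $\mathbb C$, and $d\ge2$. Let $V=\mathbb C^d\otimes\mathbb C^d$. A game is a pair $G=(G^{(1)},G^{(2)})$ of payoff tensors $G^{(i)}=(g^{(i)}_{j_1j_2})_{1\le j_1,j_2\le d}\in V$. If both tensors are nonzero, its class is $[G]=([G^{(1)}],[G^{(2)}])\in\mathbb P(V)^2$. Let $R=\mathbb C[\pi^{(1)}_1,\dots,\pi^{(1)}_d,\pi^{(2)}_1,\dots,\pi^{(2)}_d]$ be the coordinate ring of $\mathbb P^{d-1}\times\mathbb P^{d-1}$, and let $S$ be the polynomial ring over $\mathbb C$ in the $2d^2$ variables $g^{(i)}_{j_1j_2}$. Matrix convention: $G^{(1)}$ is viewed as the $d\times d$ matrix with entry $g^{(1)}_{j_1j_2}$ in row $j_1$ and column $j_2$, while $G^{(2)}$ is viewed as the $d\times d$ matrix with entry $g^{(2)}_{j_1j_2}$ in row $j_2$ and column $j_1$ (each player's own strategies index the rows). For a square matrix $A$, $A_i$ denotes the matrix obtained from $A$ by replacing its $i$-th column by the all-ones vector $\boldsymbol 1$. The Nash equilibrium scheme $\mathcal Z_{[G]}\subseteq\mathbb P^{d-1}\times\mathbb P^{d-1}$ consists of the points $([\pi^{(1)}],[\pi^{(2)}])$ with $\operatorname{rank}\begin{pmatrix}G^{(2)}\pi^{(1)}&\boldsymbol 1\end{pmatrix}\le1$ and $\operatorname{rank}\begin{pmatrix}G^{(1)}\pi^{(2)}&\boldsymbol 1\end{pmatrix}\le1$. The Nash locus is the Zariski closure $\mathcal N(Y)=\overline{\{[G]\in\mathbb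 P(V)^2:\mathcal Z_{[G]}\cap Y\ne\emptyset\}}\subseteq\mathbb P(V)^2$. ''Set-theoretically cut out by an ideal'' means equal, as a set, to its zero locus in $\mathbb P(V)^2$. For ideals $I,B$ the saturation is $I:B^\infty=\{f : fB^N\subseteq I\text{ for some }N\}$. Expected payoffs are $\Pi_i(\pi^{(1)},\pi^{(2)})=\sum_{j_1,j_2}g^{(i)}_{j_1j_2}\pi^{(1)}_{j_1}\pi^{(2)}_{j_2}$. A Nash equilibrium of a game with real payoffs is a pair $(\pi^{(1)},\pi^{(2)})\in\Delta_{d-1}\times\Delta_{d-1}$ (with $\Delta_{d-1}\subset\mathbb R^d$ the probability simplex) such that no player can increase their own expected payoff by changing only their own strategy within $\Delta_{d-1}$. It is totally mixed if all coordinates of $\pi^{(1)}$ and $\pi^{(2)}$ are strictly positive, and it lies on $Y$ if $([\pi^{(1)}],[\pi^{(2)}])\in Y$.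
   Formalization: Part (2) is false as printed (signs, vanishing determinants): positivity is proved sufficient; the equivalence is proved with each player's determinants all of one sign when neither vector is zero; in general an equilibrium forces membership in N(Y) and determinants all >0, all <0 or all 0. *)

(* Defs.v *)
From HB Require Import structures.
From mathcomp Require Import all_boot all_order all_algebra.
From mathcomp Require Import mpoly complex.
From mathcomp Require Import classical_sets reals.

Set Implicit Arguments.
Unset Strict Implicit.
Unset Printing Implicit Defensive.

Import Order.TTheory GRing.Theory Num.Theory.
Local Open Scope ring_scope.
Local Open Scope classical_set_scope.

Section Ideals.
Variable A : comNzRingType.

Definition ideal_span (T : set A) : set A :=
  [set p | exists (s : nat) (c F : 'I_s -> A),
             (forall k, T (F k)) /\ p = \sum_(k < s) c k * F k].

Definition ideal_pow (B : set A) (N : nat) : set A :=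
  ideal_span [set p | exists b : 'I_N -> A,
                        (forall k, B (b k)) /\ p = \prod_(k < N) b k].

Definition saturation (I B : set A) : set A :=
  [set f | exists N : nat, forall b, ideal_pow B N b -> I (f * b)].

End Ideals.

Section Biprojective.
Variable K : fieldType.

(* The projective space of K^n: points are the lines through the origin. *)
Definition proj (n : nat) := {U : {vspace 'rV[K]_n} | \dim U == 1%N}.

(* P = [v]; as \dim P = 1, this forces v != 0. *)
Definition is_class n (P : proj n) (v : 'rV[K]_n) : Prop := val P = <[v]>%VS.

Section Zariski.
Variables m n : nat.

(* In {mpoly K[m + n]}, the first m variables are the coordinates of the
   first factor and the last n variables those of the second factor. *)
Definition bieval (f : {mpoly K[m + n]}) (u : 'rV[K]_m) (v : 'rV[K]_n) : K :=
  f.@[fun i => row_mx u v 0 i].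

(* Vanishing is required for every choice of homogeneous coordinates. For a
   bihomogeneous f one choice suffices; over an infinite field an arbitrary f
   vanishes at p iff all its bihomogeneous components do. *)
Definition vanishes_at (f : {mpoly K[m + n]}) (p : proj m * proj n) : Prop :=
  forall u v, is_class p.1 u -> is_class p.2 v -> bieval f u v = 0.

Definition zero_locus (T : set {mpoly K[m + n]}) : set (proj m * proj n) :=
  [set p | forall f, T f -> vanishes_at f p].

Definition vanishing_ideal (Y : set (proj m * proj n)) :
    set {mpoly K[m + n]} :=
  [set f | forall p, Y p -> vanishes_at f p].

Definition zariski_closed (Z : set (proj m * proj n)) : Prop :=
  exists T, Z = zero_locus T.

Definition zariski_closure (X : set (proj m * proj n)) :
    set (proj m * proj n) :=
  [set p | forall Z, zariski_closed Z -> X `<=` Z -> Z p].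

Definition irreducible_subvariety (Y : set (proj m * proj n)) : Prop :=
  [/\ zariski_closed Y, Y !=set0 &
      forall Z1 Z2, zariski_closed Z1 -> zariski_closed Z2 ->
        Y `<=` Z1 `|` Z2 -> Y `<=` Z1 \/ Y `<=` Z2].

End Zariski.
End Biprojective.

(* \det (A_i), where A_i is A with its i-th column replaced by ones. *)
Definition det_ones (A : comNzRingType) d (M : 'M[A]_d) (i : 'I_d) : A :=
  \det (\matrix_(a < d, b < d) if b == i then 1 else M a b).

(* A payoff tensor is a matrix G with G j1 j2 = g_{j1 j2}. Hence, in the
   convention that each player's own strategies index the rows, the first
   player's matrix is G1 and the second player's is G2^T. *)
Section NashLocus.
Variables (K : fieldType) (d : nat).

Local Notation strategies := (proj K d * proj K d)%type.
Local Notation games := (proj K (d * d) * proj K (d * d))%type.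

Definition nash_scheme (g : games) : set strategies :=
  [set p | forall (G1 G2 : 'M[K]_d) (x y : 'rV[K]_d),
     is_class g.1 (mxvec G1) -> is_class g.2 (mxvec G2) ->
     is_class p.1 x -> is_class p.2 y ->
       (\rank (row_mx (G2^T *m x^T) (const_mx 1%R : 'cV[K]_d)) <= 1)%N /\
       (\rank (row_mx (G1 *m y^T) (const_mx 1%R : 'cV[K]_d)) <= 1)%N].

Definition nash_locus (Y : set strategies) : set games :=
  zariski_closure [set g | nash_scheme g `&` Y !=set0].

(* The coordinate ring of pairs of payoff tensors, whose variables are the
   entries g^(1)_{j1 j2} followed by the entries g^(2)_{j1 j2}. *)
Local Notation S := {mpoly K[d * d + d * d]}.

Definition generic_payoff1 : 'M[S]_d :=
  \matrix_(j1, j2) 'X_(lshift (d * d) (mxvec_index j1 j2)).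

Definition generic_payoff2 : 'M[S]_d :=
  \matrix_(j1, j2) 'X_(rshift (d * d) (mxvec_index j1 j2)).

Definition pibar1 : 'rV[S]_d := \row_i det_ones generic_payoff2^T i.
Definition pibar2 : 'rV[S]_d := \row_i det_ones generic_payoff1 i.

(* f(pibar1, pibar2) *)
Definition subst_pibar (f : {mpoly K[d + d]}) : S :=
  comp_mpoly [tuple row_mx pibar1 pibar2 0 i | i < d + d] f.

End NashLocus.

Section Equilibria.
Variables (R : realType) (d : nat).

Definition simplex : set 'rV[R]_d :=
  [set x | (forall j, 0 <= x 0 j) /\ \sum_(j < d) x 0 j = 1].

Definition expected_payoff (G : 'M[R]_d) (x y : 'rV[R]_d) : R :=
  \sum_(j1 < d) \sum_(j2 < d) G j1 j2 * x 0 j1 * y 0 j2.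

Definition nash_equilibrium (G1 G2 : 'M[R]_d) (x y : 'rV[R]_d) : Prop :=
  [/\ simplex x, simplex y,
      forall x', simplex x' -> expected_payoff G1 x' y <= expected_payoff G1 x y
    & forall y', simplex y' -> expected_payoff G2 x y' <= expected_payoff G2 x y].

Definition totally_mixed (x y : 'rV[R]_d) : Prop :=
  forall j, 0 < x 0 j /\ 0 < y 0 j.

Definition lies_on (x y : 'rV[R]_d) (Y : set (proj R[i] d * proj R[i] d)) :
    Prop :=
  exists p, [/\ Y p, is_class p.1 (map_mx (real_complex R) x)
              & is_class p.2 (map_mx (real_complex R) y)].

Definition has_totally_mixed_nash_on (G1 G2 : 'M[R]_d)
    (Y : set (proj R[i] d * proj R[i] d)) : Prop :=
  exists x y, [/\ nash_equilibrium G1 G2 x y, totally_mixed x y & lies_on x y Y].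

(* g is the class of the real game (G1, G2), i.e. (G1, G2) are real
   homogeneous coordinates of g. *)
Definition is_real_class (g : proj R[i] (d * d) * proj R[i] (d * d))
    (G1 G2 : 'M[R]_d) : Prop :=
  is_class g.1 (mxvec (map_mx (real_complex R) G1)) /\
  is_class g.2 (mxvec (map_mx (real_complex R) G2)).

(* All entries are positive up to one common sign: the point with homogeneous
   coordinates D has strictly positive coordinates. *)
Definition same_sign (D : 'I_d -> R) : Prop :=
  (forall i, 0 < D i) \/ (forall i, D i < 0).

End Equilibria.

(* Main.v *)
Require Import Defs.
From HB Require Import structures.
From mathcomp Require Import all_boot all_order all_algebra.
From mathcomp Require Import mpoly complex.
From mathcomp Require Import classical_sets reals.

Set Implicit Arguments.
Unset Strict Implicit.
Unset Printing Implicit Defensive.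

Import Order.TTheory GRing.Theory Num.Theory.
Local Open Scope ring_scope.
Local Open Scope classical_set_scope.

(** A pair (x, y) lies in the equilibrium scheme of a game (G1, G2) iff y
    equalizes G1 and x equalizes the transpose of G2, where x equalizes M when
    M x is a multiple of the all-ones vector. By Cramer's rule the vector D(M)
    of the determinants det M_i satisfies M D(M) = (det M) 1, and as soon as
    D(M) is nonzero every vector that equalizes M is a multiple of D(M)
    ([mulmx_cramer_row], [equalizes_cramer_row]). Hence, where both
    determinant vectors are nonzero, the scheme is the single point pibar, and
    the game belongs to the Nash locus iff the equations f_k of Y vanish at
    pibar. Both parts of the statement follow from this and from the behaviour
    at the games with a zero determinant vector.

    Let X be the set of games whose scheme meets Y, let I be the ideal of the
    f_k(pibar), and let B be the ideal by which I is saturated.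

    X lies in the zero locus of I : B^oo. The games equalized by a fixed point
    of Y form a linear space containing games whose determinant vectors are
    both nonzero. If h B^N is in I, then h b vanishes on this linear space for
    a suitable b in B^N that is not identically zero there; restricting to
    lines gives that h vanishes on it ([equalized_games_vanish],
    [nash_scheme_saturation]).

    The zero locus of I : B^oo lies in the closure of X. Usually this would be
    the Nullstellensatz, but here an explicit parametrization of X suffices.
    The matrix E = [equalizing_mx] i x M is polynomial in x and M, is equalized
    by x for every M, and equals (det M_i) M for x = D(M). Let h vanish on X,
    and substitute such matrices for both payoff matrices in h. The result, a
    polynomial in the entries of M with coefficients in the coordinates of
    (x, y), vanishes for all M whenever (x, y) is in Y, so its coefficients
    belong to the prime ideal of Y, which the f_k generate. Substituting pibar
    for (x, y) gives h(p2 G1, p1 G2) in I, where p1 and p2 are coordinates of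
    the two halves of pibar ([equalizing_substitution]). For bihomogeneous h
    this is a monomial in p1 and p2 times h, and by the pigeonhole principle h
    is in the saturation ([homogeneous_mem_saturation]). Bihomogeneous
    components of a polynomial vanishing on X vanish on X too.

    For real games, a totally mixed strategy is a best response iff all pure
    strategies have the same payoff. So totally mixed equilibria are the positive pairs equalizing both
    matrices, and when the determinant vectors are nonzero they are obtained by
    normalizing these vectors, which requires their entries to have one sign. *)
(** * Homogeneous coordinates *)

Section ProjectivePoints.
Variables (K : fieldType) (n : nat).
Implicit Types (P : proj K n) (v w : 'rV[K]_n).

Lemma is_class_neq0 P v : is_class P v -> v != 0.
Proof.
move=> hP; have := valP P; rewrite /= (hP : val P = _) dim_vline.
by case: (v =P 0).
Qed.

Lemma is_class_exists P : exists v, is_class P v.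
Proof.
have dP := valP P; exists (vpick (val P)); apply/esym/eqP.
rewrite eqEdim -memvE memv_pick dim_vline vpick0 (eqP dP).
by rewrite -dimv_eq0 (eqP dP).
Qed.

Lemma class_exists v : v != 0 -> exists P, is_class P v.
Proof.
move=> v0; have dv : \dim <[v]>%VS == 1 by rewrite dim_vline v0.
by exists (exist _ <[v]>%VS dv).
Qed.

Lemma is_classZ P v c : c != 0 -> is_class P v -> is_class P (c *: v).
Proof.
move=> c0 hP; rewrite /is_class hP; apply/eqP; rewrite eqEsubv -!memvE.
by rewrite memvZ ?memv_line // andbT -[X in X \in _](scalerK c0) memvZ ?memv_line.
Qed.

Lemma is_class_collinear P v w :
  is_class P v -> is_class P w -> exists2 c, c != 0 & w = c *: v.
Proof.
move=> hv hw; have w0 := is_class_neq0 hw.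
have: w \in <[v]>%VS by rewrite -[<[v]>%VS]hv hw memv_line.
by case/vlineP => c wE; exists c => //; apply: contraNneq w0 => c0; rewrite wE c0 scale0r.
Qed.

End ProjectivePoints.

(** * Polynomials over an infinite field *)

Section InfiniteField.
Variable K : numFieldType.

Lemma poly_vanish0 (p : {poly K}) : (forall t, p.[t] = 0) -> p = 0.
Proof.
move=> hp; apply/eqP/negP => /negP p0.
have := max_poly_roots p0 (rs := [seq k%:R | k <- iota 0 (size p)]).
rewrite size_map size_iota ltnn => H; suff: false by [].
apply: H; first by apply/allP => x _; apply/rootP/hp.
rewrite map_inj_uniq ?iota_uniq // => i j /eqP.
by rewrite eqr_nat => /eqP.
Qed.

(** Multiplying by X removes the restriction to nonzero arguments. *)
Lemma poly_vanish_units0 (p : {poly K}) : (forall t, t != 0 -> p.[t] = 0) -> p = 0.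
Proof.
move=> hp; apply/eqP; have /eqP : 'X * p = 0.
  apply: poly_vanish0 => t; rewrite hornerM hornerX.
  by have [->|/hp->] := eqVneq t 0; rewrite (mul0r, mulr0).
by rewrite mulf_eq0 polyX_eq0.
Qed.

End InfiniteField.

Lemma rmorph_mmap n (A B C : comNzRingType) (phi : {rmorphism B -> C})
    (iota : A -> B) (z : 'I_n -> B) (p : {mpoly A[n]}) :
  phi (mmap iota z p) = mmap (phi \o iota) (phi \o z) p.
Proof.
rewrite /mmap rmorph_sum; apply: eq_bigr => m _; rewrite rmorphM; congr (_ * _).
by rewrite /mmap1 rmorph_prod; apply: eq_bigr => i _; rewrite rmorphXn.
Qed.

Lemma eq_mmap n (A B : comNzRingType) (io1 io2 : A -> B) (z1 z2 : 'I_n -> B)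
    (p : {mpoly A[n]}) :
  io1 =1 io2 -> z1 =1 z2 -> mmap io1 z1 p = mmap io2 z2 p.
Proof.
by move=> e1 e2; apply: eq_bigr => m _; rewrite e1 (mmap1_eq _ e2).
Qed.


(** * Weighted homogeneous components *)

(** Two kinds of weights occur: those of a block of variables, which give the
    bidegree, and the indicator of a single variable, which gives the degree in
    that variable. *)
Definition wdeg n (w : 'I_n -> nat) (m : 'X_{1..n}) : nat :=
  (\sum_(i < n) w i * m i)%N.

Section WeightMeasure.
Variables (n : nat) (w : 'I_n -> nat).

Lemma wdeg0 : wdeg w 0%MM = 0%N.
Proof. by rewrite /wdeg big1 // => i _; rewrite mnm0E muln0. Qed.

Lemma wdegD : {morph wdeg w : m1 m2 / (m1 + m2)%MM >-> (m1 + m2)%N}.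
Proof.
by move=> m1 m2; rewrite /wdeg -big_split; apply: eq_bigr => i _; rewrite mnmDE mulnDr.
Qed.

HB.instance Definition _ := isMeasure.Build n (wdeg w) wdeg0 wdegD.

End WeightMeasure.

Notation wcomp w k := (pihomog (wdeg w) k).

Section WeightedComponents.
Variables (A : comNzRingType) (n : nat).
Implicit Types (w : 'I_n -> nat) (p : {mpoly A[n]}).

Lemma mcoeff_wcomp w k p m :
  (wcomp w k p)@_m = if wdeg w m == k then p@_m else 0.
Proof.
rewrite pihomogE raddf_sum /= big_mkcond /=.
have [m_in|m_out] := boolP (m \in msupp p).
  rewrite (bigD1_seq m) ?msupp_uniq //= big1 ?addr0 => [|m' /negPf m'_neq].
    by case: ifP; rewrite ?mcoeff0 // mcoeffZ mcoeffX eqxx mulr1.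
  by case: ifP; rewrite ?mcoeff0 // mcoeffZ mcoeffX m'_neq mulr0.
rewrite (memN_msupp_eq0 m_out) if_same big_seq big1 // => m' m'_in.
case: ifP; rewrite ?mcoeff0 // mcoeffZ mcoeffX.
by rewrite (negPf (memPn m_out _ m'_in)) mulr0.
Qed.

Lemma wcomp_homog w w' k k' p :
  p \is k.-homog for (wdeg w) -> wcomp w' k' p \is k.-homog for (wdeg w).
Proof.
move=> hp; apply/dhomogP => m; rewrite mcoeff_msupp mcoeff_wcomp.
by case: ifP => _; rewrite ?eqxx // -mcoeff_msupp; apply/dhomogP.
Qed.

Lemma wcomp_sum w p : exists N, p = \sum_(k < N) wcomp w k p.
Proof. by exists (mmeasure (wdeg w) p); apply: pihomog_partitionE. Qed.

Lemma mmap_homog (B : comNzRingType) (iota : A -> B) w k p (z : 'I_n -> B) c :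
  p \is k.-homog for (wdeg w) ->
  mmap iota (fun i => c ^+ w i * z i) p = c ^+ k * mmap iota z p.
Proof.
move=> /dhomogP hp; rewrite /mmap mulr_sumr [LHS]big_seq [RHS]big_seq.
apply: eq_bigr => m m_in; rewrite mulrCA; congr (_ * _).
rewrite -(hp m m_in) /wdeg expr_sum /mmap1 -big_split /=.
by apply: eq_bigr => i _; rewrite exprMn exprM.
Qed.

End WeightedComponents.

Section WeightedComponentsInfinite.
Variables (K : numFieldType) (n : nat).
Implicit Types (w : 'I_n -> nat) (p : {mpoly K[n]}).

(** Along the orbit of z under weighted scaling, p is a polynomial in the scaling
    parameter c whose coefficients are the values at z of its components. *)
Lemma wcomp_vanish w p (z : 'I_n -> K) :
  (forall c, c != 0 -> p.@[fun i => c ^+ w i * z i] = 0) ->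
  forall k, (wcomp w k p).@[z] = 0.
Proof.
move=> hp k; set N := maxn k.+1 (mmeasure (wdeg w) p).
have pE : p = \sum_(k < N) wcomp w k p.
  by apply: pihomog_partitionE; apply: leq_maxr.
pose q : {poly K} := \poly_(k < N) (wcomp w k p).@[z].
suff /polyP/(_ k) : q = 0 by rewrite coef_poly coef0 leq_max ltnSn.
apply: poly_vanish_units0 => c c0; rewrite -(hp c c0) [in RHS]pE horner_poly.
rewrite [RHS]raddf_sum; apply: eq_bigr => j _ /=; rewrite mulrC.
by rewrite /meval (mmap_homog _ _ _ (pihomogP _ _ _)).
Qed.

(** Taking the component of degree m_i in the i-th variable, for all i in turn,
    leaves only the monomial of exponent m, whose value at (1, .., 1) is the
    coefficient. Each of these steps preserves the vanishing of p everywhere. *)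
Lemma mpoly_vanish0 p : (forall z, p.@[z] = 0) -> p = 0.
Proof.
move=> p0; apply/mpolyP => m; rewrite mcoeff0.
pose w (i : 'I_n) j := (i == j) : nat.
have wE i (m' : 'X_{1..n}) : wdeg (w i) m' = m' i.
  rewrite /wdeg (bigD1 i) //= /w eqxx mul1n big1 ?addn0 // => j ji.
  by rewrite eq_sym (negPf ji).
pose q s := foldr (fun i q => wcomp (w i) (m i) q) p s.
have q0 s : forall z, (q s).@[z] = 0.
  by elim: s => [//|i s IHs] z /=; apply: wcomp_vanish => c _; apply: IHs.
have qE s m' : (q s)@_m' = if all (fun i => m' i == m i) s then p@_m' else 0.
  elim: s => [//|i s IHs] /=; rewrite mcoeff_wcomp wE.
  by case: eqP => //=; rewrite IHs.
have {qE}qE : q (enum 'I_n) = p@_m *: 'X_[m].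
  apply/mpolyP => m'; rewrite qE mcoeffZ mcoeffX; have [<-|mm'] := eqVneq m m'.
    by rewrite mulr1 ifT //; apply/allP.
  rewrite mulr0 ifN //; apply: contra mm' => /allP mm'; apply/eqP/mnmP => i.
  by apply/esym/eqP/mm'; rewrite mem_enum.
have := q0 (enum 'I_n) (fun=> 1); rewrite qE mevalZ mevalX big1 ?mulr1 //.
by move=> i _; rewrite expr1n.
Qed.

(** Density of the complement of q = 0, in the form used below: on the line
    through z and z', p q = 0 as a polynomial in t while q is not zero. *)
Lemma line_vanish (p q : {mpoly K[n]}) (z z' : 'rV[K]_n) :
  (forall t, let u := (z + t *: (z' - z)) 0 in p.@[u] * q.@[u] = 0) ->
  q.@[z' 0] != 0 -> p.@[z 0] = 0.
Proof.
pose l (i : 'I_n) := (z 0 i)%:P + 'X * (z' 0 i - z 0 i)%:P.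
pose r (p : {mpoly K[n]}) := mmap polyC l p.
have rE s t : (r s).[t] = s.@[(z + t *: (z' - z)) 0].
  rewrite -[LHS]/(horner_eval t (r s)) /r rmorph_mmap; apply: eq_mmap => i /=.
    by rewrite /horner_eval hornerC.
  by rewrite /horner_eval /l !hornerE !mxE.
move=> pq0 q0; have /eqP : r p * r q = 0.
  by apply: poly_vanish0 => t; rewrite hornerM !rE pq0.
rewrite mulf_eq0 => /orP[/eqP rp0|/eqP rq0].
  by have := rE p 0; rewrite rp0 horner0 scale0r addr0.
have := rE q 1; rewrite rq0 horner0 scale1r addrC subrK => q1.
by rewrite -q1 eqxx in q0.
Qed.

End WeightedComponentsInfinite.

(** * Ideals *)

Section IdealSpan.
Variable A : comNzRingType.
Implicit Types (T : set A) (a b : A).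

Lemma ideal_span_sub T a : T a -> ideal_span T a.
Proof.
move=> Ta; exists 1%N, (fun=> 1), (fun=> a); split=> //.
by rewrite big_ord1 mul1r.
Qed.

Lemma ideal_span0 T : ideal_span T 0.
Proof. by exists 0%N, (fun=> 0), (fun=> 0); split=> [[]//|]; rewrite big_ord0. Qed.

Lemma ideal_spanD T a b : ideal_span T a -> ideal_span T b -> ideal_span T (a + b).
Proof.
move=> [s1 [c1 [F1 [T1 ->]]]] [s2 [c2 [F2 [T2 ->]]]].
pose join (g1 : 'I_s1 -> A) (g2 : 'I_s2 -> A) k :=
  match split k with inl i => g1 i | inr i => g2 i end.
have joinl g1 g2 i : join g1 g2 (lshift s2 i) = g1 i.
  by rewrite /join (unsplitK (inl i)).
have joinr g1 g2 i : join g1 g2 (rshift s1 i) = g2 i.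
  by rewrite /join (unsplitK (inr i)).
exists (s1 + s2)%N, (join c1 c2), (join F1 F2); split.
  by rewrite /join => k; case: split.
rewrite big_split_ord; congr (_ + _); apply: eq_bigr => i _.
  by rewrite !joinl.
by rewrite !joinr.
Qed.

Lemma ideal_spanM T a b : ideal_span T b -> ideal_span T (a * b).
Proof.
move=> [s [c [F [TF ->]]]]; exists s, (fun k => a * c k), F; split=> //.
by rewrite mulr_sumr; apply: eq_bigr => k _; rewrite mulrA.
Qed.

Lemma ideal_span_sum T (I : Type) (r : seq I) (P : pred I) (F : I -> A) :
  (forall i, P i -> ideal_span T (F i)) -> ideal_span T (\sum_(i <- r | P i) F i).
Proof.
move=> TF; elim/big_rec: _ => [|i x Pi Tx]; first exact: ideal_span0.
by apply: ideal_spanD => //; apply: TF.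
Qed.

(** The definition of [ideal_span] allows repeated generators; for a finite
    family they can be collected, with one coefficient for each index. *)
Lemma ideal_span_range n (x : 'I_n -> A) b :
  ideal_span (range x) b -> exists c : 'I_n -> A, b = \sum_(i < n) c i * x i.
Proof.
move=> [s [c [F [TF ->]]]]; elim/big_rec: _ => [|k _ _ [e ->]].
  by exists (fun=> 0); rewrite big1 // => i _; rewrite mul0r.
have [i _ <-] := TF k; exists (fun j => (if j == i then c k else 0) + e j).
under [RHS]eq_bigr do rewrite mulrDl; rewrite big_split; congr (_ + _).
rewrite (bigD1 i) //= eqxx big1 ?addr0 // => j /negPf->.
by rewrite mul0r.
Qed.

(** Expanding the product gives monomials of degree n e + 1 in n variables, each
    of which is divisible by the e-th power of some variable. *)
Lemma ideal_span_pigeonhole T n (x : 'I_n -> A) e g (b : 'I_(n * e).+1 -> A) :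
  (forall i, ideal_span T (g * x i ^+ e)) ->
  (forall k, ideal_span (range x) (b k)) ->
  ideal_span T (g * \prod_k b k).
Proof.
move=> gx xb; have /boolp.choice [c bE] k := ideal_span_range (xb k).
rewrite (eq_bigr _ (fun k _ => bE k)) bigA_distr_bigA mulr_sumr /=.
apply: ideal_span_sum => phi _; rewrite big_split /=.
have [i ei] : exists i, (e <= #|[pred k | phi k == i]|)%N.
  case: (boolP [exists i, (e <= #|[pred k | phi k == i]|)%N]) => [/existsP//|].
  rewrite negb_exists => /forallP small; have: (#|'I_(n * e).+1| <= n * e)%N.
    rewrite -sum1_card (partition_big phi predT) //=.
    rewrite -[X in (_ <= X * _)%N]card_ord -sum_nat_const; apply: leq_sum => i _.
    by rewrite sum1_card ltnW // ltnNge small.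
  by rewrite card_ord ltnn.
rewrite (bigID (fun k => phi k == i) _ (fun k => x (phi k))) /=.
rewrite (eq_bigr (fun=> x i) (fun k (ki : phi k == i) => congr1 x (eqP ki))).
rewrite prodr_const -[X in x i ^+ X](subnKC ei) exprD.
by rewrite -(mulrA (x i ^+ e)) mulrCA (mulrA g) mulrCA mulrC -mulrA; do 2!apply: ideal_spanM.
Qed.

(** A product of elements of the intersection splits into a long product of
    elements of the first ideal and a long one of elements of the second, so the
    pigeonhole argument applies to each half separately. *)
Lemma saturation_pigeonhole T n (x y : 'I_n -> A) ex ey h :
  (forall i j, ideal_span T (x i ^+ ex * y j ^+ ey * h)) ->
  saturation (ideal_span T) (ideal_span (range x) `&` ideal_span (range y)) h.
Proof.
move=> hT; exists ((n * ex).+1 + (n * ey).+1)%N => _ [s [c [F [hF ->]]]].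
rewrite mulr_sumr; apply: ideal_span_sum => k _; rewrite mulrCA.
apply: ideal_spanM; have [b [hb ->]] := hF k; rewrite big_split_ord /= mulrA.
apply: (ideal_span_pigeonhole (x := y)) => [j|l]; last by case: (hb (rshift _ l)).
rewrite mulrAC; apply: (ideal_span_pigeonhole (x := x)) => [i|l].
  by rewrite -mulrA mulrC (mulrC (y j ^+ ey)); apply: hT.
by case: (hb (lshift _ l)).
Qed.

End IdealSpan.

Lemma ideal_span_rmorph (A B : comNzRingType) (phi : {rmorphism A -> B}) n
    (x : 'I_n -> A) b :
  ideal_span (range x) b -> ideal_span (range (phi \o x)) (phi b).
Proof.
move=> /ideal_span_range[c ->]; rewrite rmorph_sum; apply: ideal_span_sum => i _.
by rewrite rmorphM; apply: ideal_spanM; apply: ideal_span_sub; exists i.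
Qed.


(** * Mixed strategies that equalize the payoffs *)

Definition cramer_row (A : comNzRingType) d (M : 'M[A]_d) : 'rV[A]_d :=
  \row_i det_ones M i.

Section CramerRow.
Variables (A : comNzRingType) (d : nat).
Implicit Types (M : 'M[A]_d) (x : 'rV[A]_d).

(** Expanding along the column of ones shows that the det M_i are the entries of
    the adjugate of M applied to the all-ones vector. *)
Lemma det_onesE M i : det_ones M i = \sum_k (\adj M) i k.
Proof.
rewrite /det_ones (expand_det_col _ i); apply: eq_bigr => k _.
rewrite !mxE eqxx mul1r /cofactor; congr (_ * \det _).
by apply/matrixP => a b; rewrite !mxE eq_sym (negPf (neq_lift _ _)).
Qed.

Lemma mulmx_cramer_row M : M *m (cramer_row M)^T = const_mx (\det M).
Proof.
have -> : (cramer_row M)^T = \adj M *m const_mx 1.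
  apply/colP => i; rewrite !mxE det_onesE; apply: eq_bigr => k _.
  by rewrite [const_mx _ _ _]mxE mulr1.
rewrite mulmxA mul_mx_adj; move: (\det M) => D.
by apply/colP => i; rewrite mul_scalar_mx !mxE mulr1.
Qed.

(** The matrix with entries x_i M_ab has the right product with x as soon as its
    i-th column is corrected, and after the scaling by x_i this correction needs
    no division. The multiple det M of the all-ones vector is the one for which
    the vector [cramer_row] M gives back M up to a scalar. *)
Definition equalizing_mx (i : 'I_d) x M : 'M[A]_d :=
  \matrix_(a, b) (if b == i then \det M - \sum_(c < d | c != i) x 0 c * M a c
                  else x 0 i * M a b).

Lemma mulmx_equalizing_mx i x M :
  equalizing_mx i x M *m x^T = const_mx (x 0 i * \det M).
Proof.
rewrite /equalizing_mx; move: (\det M) => D.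
apply/colP => a; rewrite !mxE (bigD1 i) //= !mxE eqxx mulrBl mulr_suml.
rewrite [D * _]mulrC -addrA [X in _ + X]addrC [X in _ + X](_ : _ = 0) ?addr0 //.
rewrite -sumrB big1 // => c ci; rewrite !mxE (negPf ci) mulrC mulrA.
by rewrite (mulrC (x 0 c * _)) mulrCA mulrA subrr.
Qed.

Lemma equalizing_mx_cramer_row i M :
  equalizing_mx i (cramer_row M) M = det_ones M i *: M.
Proof.
have := mulmx_cramer_row M; rewrite /equalizing_mx; move: (\det M) => D MD.
apply/matrixP => a b; rewrite !mxE; case: eqP => // ->.
have /colP/(_ a) := MD; rewrite !mxE => <-.
rewrite (bigD1 i) //= !mxE mulrC -addrA -sumrB big1 ?addr0 // => c _.
by rewrite !mxE mulrC subrr.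
Qed.

(** Every nonzero x thus equalizes a matrix with a nonzero determinant vector. *)
Lemma det_ones_equalizing_mx1 i x :
  det_ones (equalizing_mx i x 1%:M) i = x 0 i ^+ d.-1.
Proof.
have -> : det_ones (equalizing_mx i x 1%:M) i = det_ones (x 0 i *: 1%:M) i.
  congr (\det _); apply/matrixP => a b; rewrite !mxE.
  by case: eqP.
rewrite det_onesE adjZ adj1 (bigD1 i) //= !mxE eqxx mulr1 big1 ?addr0 // => k ki.
by rewrite !mxE eq_sym (negPf ki) mulr0.
Qed.

End CramerRow.

Lemma map_det_ones (A B : comNzRingType) (phi : {rmorphism A -> B}) d (M : 'M[A]_d) i :
  det_ones (map_mx phi M) i = phi (det_ones M i).
Proof.
rewrite /det_ones -det_map_mx; congr (\det _); apply/matrixP => a b; rewrite !mxE.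
by case: eqP; rewrite ?rmorph1.
Qed.

Lemma map_equalizing_mx (A B : comNzRingType) (phi : {rmorphism A -> B}) d i
    (x : 'rV[A]_d) (M : 'M[A]_d) :
  map_mx phi (equalizing_mx i x M) = equalizing_mx i (map_mx phi x) (map_mx phi M).
Proof.
rewrite /equalizing_mx det_map_mx; move: (\det M) => D.
apply/matrixP => a b; rewrite !mxE; case: eqP => _; last by rewrite rmorphM.
rewrite rmorphB rmorph_sum; congr (_ - _); apply: eq_bigr => c _.
by rewrite rmorphM !mxE.
Qed.

Definition equalizes (A : comNzRingType) d (M : 'M[A]_d) (x : 'rV[A]_d) : Prop :=
  exists l, M *m x^T = const_mx l.

Section Equalizes.
Variables (K : fieldType) (d : nat).
Implicit Types (M : 'M[K]_d) (x : 'rV[K]_d).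

Lemma equalizesZ M x a b : equalizes M x -> equalizes (a *: M) (b *: x).
Proof.
move=> [l Ml]; exists (a * (b * l)).
by rewrite linearZ -scalemxAl -scalemxAr Ml; apply/colP => i; rewrite !mxE.
Qed.

Lemma equalizes_line M N x t :
  equalizes M x -> equalizes N x -> equalizes (M + t *: (N - M)) x.
Proof.
move=> [l Ml] [l' Nl]; exists (l + t * (l' - l)).
rewrite mulmxDl -scalemxAl mulmxBl Ml Nl.
by apply/colP => i; rewrite !mxE.
Qed.

Lemma equalizes_rank M x : x != 0 ->
  (\rank (row_mx (M *m x^T) (const_mx 1%R : 'cV[K]_d)) <= 1)%N <-> equalizes M x.
Proof.
move=> x0; set u : 'cV[K]_d := const_mx 1.
have u0 : u != 0.
  have [i _] : exists i, x 0 i != 0 by apply/rV0Pn.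
  by apply/cV0Pn; exists i; rewrite mxE oner_eq0.
split=> [|[l ->]]; last first.
  have -> : row_mx (const_mx l) u = u *m row_mx (const_mx l : 'M_1) (const_mx 1%R : 'M_1).
    rewrite mul_mx_row; congr row_mx; apply/matrixP => a b;
    by rewrite !mxE big_ord1 !mxE mul1r.
  by apply: leq_trans (mxrankM_maxl _ _) _; apply: rank_leq_col.
rewrite -mxrank_tr tr_row_mx -addsmxE => rk1.
have : (((M *m x^T)^T + u^T)%MS <= u^T)%MS.
  rewrite -(geq_leqif (mxrank_leqif_sup (addsmxSr _ _))) (leq_trans rk1) //.
  by rewrite lt0n mxrank_eq0 -(inj_eq (@trmx_inj _ _ _)) trmxK trmx0.
rewrite addsmx_sub => /andP[/sub_rVP[l E] _]; exists l.
apply: trmx_inj; rewrite E; apply/rowP => i.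
by rewrite !mxE mulr1.
Qed.

(** The difference z of the two sides has i-th entry 0, and M z = mu 1. If N is M
    with its i-th column replaced by the all-ones vector, then N agrees with M on
    z and maps the i-th basis vector e_i to the all-ones vector, so N kills
    z - mu e_i. Since N is invertible, z = mu e_i, and its i-th entry gives
    mu = 0. *)
Lemma equalizes_cramer_row M x i : det_ones M i != 0 -> equalizes M x ->
  det_ones M i *: x = x 0 i *: cramer_row M.
Proof.
move=> D0 [l Ml]; set z := det_ones M i *: x - x 0 i *: cramer_row M.
suff z0 : z^T = 0 by apply/eqP; rewrite -subr_eq0 -[_ - _]trmxK -/z z0 trmx0.
have zi : z 0 i = 0 by rewrite !mxE mulrC subrr.
pose mu := det_ones M i * l - x 0 i * \det M.
have Mz : M *m z^T = const_mx mu.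
  have -> : z^T = det_ones M i *: x^T - x 0 i *: (cramer_row M)^T.
    by apply/colP => a; rewrite !mxE.
  rewrite mulmxBr -!scalemxAr Ml mulmx_cramer_row.
  by apply/colP => a; rewrite !mxE.
pose N := \matrix_(a < d, b < d) if b == i then 1 else M a b.
have Nunit : N \in unitmx by rewrite unitmxE unitfE.
have : z^T - mu *: delta_mx i 0 = 0.
  rewrite -[LHS](mulKmx Nunit) [X in _ *m X](_ : _ = 0) ?mulmx0 //.
  rewrite mulmxBr -scalemxAr -colE; apply/colP => a; rewrite !mxE eqxx mulr1.
  have /colP/(_ a) := Mz; rewrite !mxE => <-; apply/eqP; rewrite subr_eq0.
  apply/eqP/eq_bigr => b _; rewrite !mxE; case: eqP => [->|//].
  by have := zi; rewrite !mxE => ->; rewrite !mulr0.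
move/eqP; rewrite subr_eq0 => /eqP zE.
have /colP/(_ i) := zE; rewrite [LHS]mxE zi !mxE !eqxx mulr1 => mu0.
by rewrite zE -mu0 scale0r.
Qed.

End Equalizes.

(** * Games and the equilibrium scheme *)

Section Games.
Variables (K : fieldType) (d : nat).
Implicit Types (G : 'M[K]_d) (x y : 'rV[K]_d).

Lemma nash_schemeP (g : proj K (d * d) * proj K (d * d)) (p : proj K d * proj K d)
    G1 G2 x y :
  is_class g.1 (mxvec G1) -> is_class g.2 (mxvec G2) ->
  is_class p.1 x -> is_class p.2 y ->
  nash_scheme g p <-> equalizes G1 y /\ equalizes G2^T x.
Proof.
move=> hG1 hG2 hx hy; split=> [/(_ _ _ _ _ hG1 hG2 hx hy)[]|[e1 e2]].
  move=> /(equalizes_rank _ (is_class_neq0 hx)) e2.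
  by move=> /(equalizes_rank _ (is_class_neq0 hy)).
move=> H1 H2 x' y' hH1 hH2 hx' hy'.
have [a1 _ /(canRL mxvecK) H1E] := is_class_collinear hG1 hH1.
have [a2 _ /(canRL mxvecK) H2E] := is_class_collinear hG2 hH2.
have [b1 _ x'E] := is_class_collinear hx hx'.
have [b2 _ y'E] := is_class_collinear hy hy'.
split; apply/equalizes_rank; rewrite ?(is_class_neq0 hx') ?(is_class_neq0 hy') // ?x'E ?y'E.
  by rewrite H2E linearZ /= mxvecK linearZ /=; apply: equalizesZ.
by rewrite H1E linearZ /= mxvecK; apply: equalizesZ.
Qed.

Lemma ideal_span_vanish n s (x : 'I_s -> {mpoly K[n]}) b (z : 'I_n -> K) :
  ideal_span (range x) b -> (forall k, (x k).@[z] = 0) -> b.@[z] = 0.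
Proof.
move=> /ideal_span_range[c ->] x0; rewrite raddf_sum big1 // => k _ /=.
by rewrite mevalM x0 mulr0.
Qed.

Lemma mxvec_block (A : Type) (z : 'I_(d * d + d * d) -> A) k :
  row_mx (mxvec (\matrix_(a < d, b < d) z (lshift (d * d) (mxvec_index a b))))
         (mxvec (\matrix_(a < d, b < d) z (rshift (d * d) (mxvec_index a b)))) 0 k
  = z k.
Proof.
case: (split_ordP k) => j ->; rewrite ?row_mxEl ?row_mxEr;
by case/mxvec_indexP: j => a b; rewrite mxvecE mxE.
Qed.

Lemma map_generic_payoff1 G1 G2 :
  map_mx (meval (row_mx (mxvec G1) (mxvec G2) 0)) (generic_payoff1 K d) = G1.
Proof. by apply/matrixP => a b; rewrite !mxE mevalXU row_mxEl mxvecE. Qed.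

Lemma map_generic_payoff2 G1 G2 :
  map_mx (meval (row_mx (mxvec G1) (mxvec G2) 0)) (generic_payoff2 K d) = G2.
Proof. by apply/matrixP => a b; rewrite !mxE mevalXU row_mxEr mxvecE. Qed.

Lemma meval_pibar1 G1 G2 i :
  (pibar1 K d 0 i).@[row_mx (mxvec G1) (mxvec G2) 0] = det_ones G2^T i.
Proof. by rewrite mxE -map_det_ones -matrix.map_trmx map_generic_payoff2. Qed.

Lemma meval_pibar2 G1 G2 i :
  (pibar2 K d 0 i).@[row_mx (mxvec G1) (mxvec G2) 0] = det_ones G1 i.
Proof. by rewrite mxE -map_det_ones map_generic_payoff1. Qed.

Lemma meval_subst_pibar (f : {mpoly K[d + d]}) G1 G2 :
  (subst_pibar f).@[row_mx (mxvec G1) (mxvec G2) 0]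
  = bieval f (cramer_row G2^T) (cramer_row G1).
Proof.
rewrite /subst_pibar comp_mpoly_meval; apply: meval_eq => k.
rewrite tnth_mktuple; case: (split_ordP k) => j ->.
  by rewrite !row_mxEl meval_pibar1 mxE.
by rewrite !row_mxEr meval_pibar2 mxE.
Qed.

End Games.

(** * Equations of the subvariety *)

Section Subvariety.
Variables (K : fieldType) (d s : nat) (Y : set (proj K d * proj K d)).
Variable f : 'I_s -> {mpoly K[d + d]}.
Hypothesis Yideal : vanishing_ideal Y = ideal_span (range f).

Lemma generators_vanish p x y k :
  Y p -> is_class p.1 x -> is_class p.2 y -> bieval (f k) x y = 0.
Proof.
move=> Yp hx hy; have : vanishing_ideal Y (f k).
  by rewrite Yideal; apply: ideal_span_sub; exists k.
by move/(_ p Yp x y hx hy).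
Qed.

(** The equations vanish at one choice of coordinates, while membership in Y
    concerns all of them. Rescaling the variables of a polynomial t that vanishes on Y gives again an element of the
    ideal of Y, so t vanishes at all choices of coordinates. *)
Lemma mem_subvariety p x y : zariski_closed Y ->
  is_class p.1 x -> is_class p.2 y -> (forall k, bieval (f k) x y = 0) -> Y p.
Proof.
move=> [T YE] hx hy fxy; rewrite YE => t Tt x' y' hx' hy'.
have [a a0 ->] := is_class_collinear hx hx'.
have [b b0 ->] := is_class_collinear hy hy'.
pose sc i : {mpoly K[d + d]} :=
  (row_mx (const_mx a : 'rV_d) (const_mx b : 'rV_d) 0 i)%:MP * 'X_i.
have scE u v : bieval (mmap (@mpolyC _ K) sc t) u v = bieval t (a *: u) (b *: v).
  rewrite /bieval rmorph_mmap; apply: eq_mmap => i /=; first by rewrite mevalC.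
  rewrite mevalM mevalC mevalXU.
  by case: (split_ordP i) => j ->; rewrite ?row_mxEl ?row_mxEr !mxE.
rewrite -scE; apply: (@ideal_span_vanish _ _ _ f) => //.
rewrite -Yideal => q Yq u v hu hv; rewrite scE.
by move: Yq; rewrite YE; apply=> //; apply: is_classZ.
Qed.

End Subvariety.

(** * The Nash locus *)

Section NashLocusEquations.
Variables (K : numFieldType) (d s : nat) (Y : set (proj K d * proj K d)).
Variable f : 'I_s -> {mpoly K[d + d]}.
Hypothesis Yideal : vanishing_ideal Y = ideal_span (range f).

Local Notation n := (d * d + d * d)%N.
Local Notation S := {mpoly K[n]}.
Local Notation "[ 'game' G1 , G2 ]" := (row_mx (mxvec G1) (mxvec G2)).
Local Notation Inash := (ideal_span (range (fun k => subst_pibar (f k)))).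
Local Notation B := (ideal_span (range (fun i => pibar1 K d 0 i)) `&`
                     ideal_span (range (fun i => pibar2 K d 0 i))).

(** The games equalized by a fixed pair (x, y) form a linear space. It contains
    the pair of matrices that [equalizing_mx] builds from the identity, so a
    polynomial q that is nonzero there is nonzero at all but finitely many
    points of the line from any other such game to this one. Thus a polynomial
    that vanishes on the generic part of this space vanishes on all of it. *)
Lemma equalized_games_vanish (h q : S) x y i j (G1 G2 : 'M[K]_d) :
  (forall H1 H2, equalizes H1 y -> equalizes H2^T x ->
     h.@[[game H1, H2] 0] * q.@[[game H1, H2] 0] = 0) ->
  q.@[[game equalizing_mx i y 1%:M, (equalizing_mx j x 1%:M)^T] 0] != 0 ->
  equalizes G1 y -> equalizes G2^T x -> h.@[[game G1, G2] 0] = 0.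
Proof.
move=> hq q0 G1y G2x; apply: (line_vanish (q := q)) q0 => t.
rewrite opp_row_mx add_row_mx scale_row_mx add_row_mx -!linearB -!linearZ -!linearD.
apply: hq; first by apply: equalizes_line => //; eexists; apply: mulmx_equalizing_mx.
rewrite linearD /= linearZ /= linearB /= trmxK.
by apply: equalizes_line => //; eexists; apply: mulmx_equalizing_mx.
Qed.

Lemma is_class_cramer_row (P : proj K d) x (M : 'M[K]_d) i :
  is_class P x -> equalizes M x -> det_ones M i != 0 -> is_class P (cramer_row M).
Proof.
move=> hx Mx Di; have E := equalizes_cramer_row Di Mx.
have xi : x 0 i != 0.
  apply: contraNneq (is_class_neq0 hx) => xi0; move: E; rewrite xi0 scale0r => /eqP.
  by rewrite scaler_eq0 (negPf Di).
have -> : cramer_row M = ((x 0 i)^-1 * det_ones M i) *: x.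
  by rewrite -scalerA E scalerA mulVf // scale1r.
by apply: is_classZ => //; rewrite mulf_neq0 // invr_eq0.
Qed.

Lemma nash_ideal_vanish p x y (G1 G2 : 'M[K]_d) i j b :
  Y p -> is_class p.1 x -> is_class p.2 y ->
  equalizes G1 y -> equalizes G2^T x ->
  det_ones G1 i != 0 -> det_ones G2^T j != 0 ->
  Inash b -> b.@[[game G1, G2] 0] = 0.
Proof.
move=> Yp hx hy G1y G2x Di Dj hb; apply: (ideal_span_vanish hb) => k.
rewrite meval_subst_pibar; apply: (generators_vanish Yideal k Yp).
  exact: is_class_cramer_row hx G2x Dj.
exact: is_class_cramer_row hy G1y Di.
Qed.

(** The multiplier b is a power of a product of one coordinate of each half of
    pibar. Where b vanishes there is nothing to prove for h b; elsewhere pibar is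
    the given point of Y and all of I vanishes. *)
Lemma nash_scheme_saturation g :
  nash_scheme g `&` Y !=set0 -> zero_locus (saturation Inash B) g.
Proof.
move=> [p [gp Yp]] h [N hN] u v hu hv.
have [x hx] := is_class_exists p.1; have [y hy] := is_class_exists p.2.
rewrite -(vec_mxK u) in hu *; rewrite -(vec_mxK v) in hv *.
move: (vec_mx u) (vec_mx v) hu hv => G1 G2 hu hv {u v}.
have [G1y G2x] := (nash_schemeP hu hv hx hy).1 gp.
have /rV0Pn[j xj] := is_class_neq0 hx; have /rV0Pn[i yi] := is_class_neq0 hy.
(* The exponent N.+1 makes b vanish where one of its factors does, even if N = 0. *)
pose b := (pibar1 K d 0 j * pibar2 K d 0 i) ^+ N.+1.
have bE H1 H2 : b.@[[game H1, H2] 0] = (det_ones H2^T j * det_ones H1 i) ^+ N.+1.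
  by rewrite rmorphXn /= mevalM meval_pibar1 meval_pibar2.
have Ihb : Inash (h * b).
  rewrite /b exprS mulrCA; apply: ideal_spanM; apply: hN; apply: ideal_span_sub.
  exists (fun=> pibar1 K d 0 j * pibar2 K d 0 i).
  split=> [_|]; last by rewrite prodr_const card_ord.
  split; last by apply: ideal_spanM; apply: ideal_span_sub; exists i.
  by rewrite mulrC; apply: ideal_spanM; apply: ideal_span_sub; exists j.
apply: (equalized_games_vanish (q := b) (i := i) (j := j) _ _ G1y G2x) => [H1 H2 H1y H2x|].
  have [b0|] := eqVneq (b.@[[game H1, H2] 0]) 0; first by rewrite b0 mulr0.
  rewrite [in X in X -> _]bE expf_eq0 mulf_eq0 negb_or => /andP[Dj Di].
  by rewrite -mevalM; apply: (nash_ideal_vanish Yp hx hy H1y H2x Di Dj Ihb).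
by rewrite bE trmxK !det_ones_equalizing_mx1 expf_neq0 // mulf_neq0 // expf_neq0.
Qed.

(** Vanishing on the affine cone over the set of games whose scheme meets Y,
    including the pairs with a zero payoff matrix, which have no class. *)
Definition vanishes_on_equalized (h : S) : Prop :=
  forall p x y G1 G2, Y p -> is_class p.1 x -> is_class p.2 y ->
    equalizes G1 y -> equalizes G2^T x -> h.@[[game G1, G2] 0] = 0.

(** The pairs with a zero payoff matrix are limits of pairs of nonzero matrices in
    the same linear space; q is a product of two matrix entries. *)
Lemma vanishes_on_equalizedP h :
  (forall g, nash_scheme g `&` Y !=set0 -> vanishes_at h g) ->
  vanishes_on_equalized h.
Proof.
move=> hX p x y G1 G2 Yp hx hy G1y G2x.
have /rV0Pn[j xj] := is_class_neq0 hx; have /rV0Pn[i yi] := is_class_neq0 hy.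
pose q : S := 'X_(lshift _ (mxvec_index i i)) * 'X_(rshift _ (mxvec_index j j)).
have qE H1 H2 : q.@[[game H1, H2] 0] = H1 i i * H2 j j.
  by rewrite mevalM !mevalXU row_mxEl row_mxEr !mxvecE.
apply: (equalized_games_vanish (q := q) (i := i) (j := j) _ _ G1y G2x) => [H1 H2 H1y H2x|].
  have [q0|] := eqVneq (q.@[[game H1, H2] 0]) 0; first by rewrite q0 mulr0.
  rewrite qE mulf_eq0 negb_or => /andP[H10 H20].
  have /class_exists[g1 hg1] : mxvec H1 != 0.
    by rewrite mxvec_eq0; apply: contraNneq H10 => ->; rewrite mxE.
  have /class_exists[g2 hg2] : mxvec H2 != 0.
    by rewrite mxvec_eq0; apply: contraNneq H20 => ->; rewrite mxE.
  have h0 : h.@[[game H1, H2] 0] = 0.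
    apply: (hX (g1, g2)) => //; exists p; split=> //.
    exact: (nash_schemeP (g := (g1, g2)) hg1 hg2 hx hy).2 (conj H1y H2x).
  by rewrite h0 mul0r.
have E k z : equalizing_mx k z 1%:M k k = 1 :> K.
  rewrite mxE eqxx det1 big1 ?subr0 // => c ck.
  by rewrite mxE eq_sym (negPf ck) mulr0.
by rewrite qE E mul1r mxE E oner_eq0.
Qed.

Definition block_weight (a b : nat) (k : 'I_n) : nat :=
  match split k with inl _ => a | inr _ => b end.

Lemma block_weight_row (A : comNzRingType) (c : A) a b (u v : 'rV[A]_(d * d)) k :
  c ^+ block_weight a b k * row_mx u v 0 k
  = row_mx (c ^+ a *: u) (c ^+ b *: v) 0 k.
Proof.
by rewrite /block_weight !mxE; case: (split k) => j; rewrite mxE.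
Qed.

(** Scaling the two payoff matrices separately preserves the equalization. *)
Lemma vanishes_on_equalized_wcomp h a b k :
  vanishes_on_equalized h -> vanishes_on_equalized (wcomp (block_weight a b) k h).
Proof.
move=> hh p x y G1 G2 Yp hx hy G1y G2x; apply: wcomp_vanish => c _.
rewrite (meval_eq _ (block_weight_row c a b _ _)) -!linearZ.
apply: (hh p x y) => //; first by rewrite -[y]scale1r; apply: equalizesZ.
by rewrite linearZ -[x]scale1r; apply: equalizesZ.
Qed.

(** P below is h with both payoff matrices replaced by [equalizing_mx], as a
    polynomial in generic matrices A1, A2 whose coefficients are polynomials in
    the coordinates (X, Z) of a pair of strategies. Specializing (X, Z) to a
    point of Y kills P, so its coefficients are combinations of the f_k;
    specializing (X, Z) to pibar by theta gives h at multiples of the generic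
    payoff matrices. *)
Lemma equalizing_substitution h (i j : 'I_d) :
  vanishes_on_equalized h ->
  Inash (mmap (@mpolyC n K)
    (row_mx (mxvec (pibar2 K d 0 i *: generic_payoff1 K d))
            (mxvec (pibar1 K d 0 j *: generic_payoff2 K d)) 0) h).
Proof.
move=> hh; pose T := {mpoly {mpoly K[d + d]}[n]}.
pose X : 'rV[T]_d := \row_k ('X_(lshift d k))%:MP.
pose Z : 'rV[T]_d := \row_k ('X_(rshift d k))%:MP.
pose A1 : 'M[T]_d := \matrix_(a, b) 'X_(lshift (d * d) (mxvec_index a b)).
pose A2 : 'M[T]_d := \matrix_(a, b) 'X_(rshift (d * d) (mxvec_index a b)).
pose E : 'rV[T]_n := row_mx (mxvec (equalizing_mx i Z A1))
                            (mxvec (equalizing_mx j X A2^T)^T).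
have mapE (C : comNzRingType) (phi : {rmorphism T -> C}) k :
    phi (E 0 k) = row_mx (mxvec (equalizing_mx i (map_mx phi Z) (map_mx phi A1)))
      (mxvec (equalizing_mx j (map_mx phi X) (map_mx phi A2)^T)^T) 0 k.
  rewrite matrix.map_trmx -!map_equalizing_mx matrix.map_trmx.
  by rewrite -!map_mxvec -map_row_mx [RHS]mxE.
pose P : T := mmap (@mpolyC n _ \o @mpolyC (d + d) K) (E 0) h.
pose subst := comp_mpoly [tuple row_mx (pibar1 K d) (pibar2 K d) 0 k | k < d + d].
pose theta := mmap subst (fun k => 'X_k : S).
have P_coef m : vanishing_ideal Y P@_m.
  move=> p Yp x y hx hy; pose pi := row_mx x y 0.
  suff Pv : map_mpoly (meval pi) P = 0.
    by rewrite /bieval -(mcoeff_map_mpoly _ m) Pv mcoeff0.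
  apply: mpoly_vanish0 => z; pose psi := mmap (meval pi) z.
  have -> : (map_mpoly (meval pi) P).@[z] = psi P.
    rewrite /map_mpoly rmorph_mmap; apply: eq_mmap => k /=; first by rewrite mevalC.
    by rewrite mevalXU.
  rewrite /psi rmorph_mmap -/psi.
  pose G1 := \matrix_(a < d, b < d) z (lshift (d * d) (mxvec_index a b)).
  pose G2 := \matrix_(a < d, b < d) z (rshift (d * d) (mxvec_index a b)).
  have psi1 : map_mx psi A1 = G1.
    by apply/matrixP => a b; rewrite !mxE /psi mmapX mmap1U.
  have psi2 : map_mx psi A2 = G2.
    by apply/matrixP => a b; rewrite !mxE /psi mmapX mmap1U.
  have psiX : map_mx psi X = x.
    by apply/rowP => k; rewrite !mxE /psi mmapC /= mevalXU /pi row_mxEl.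
  have psiZ : map_mx psi Z = y.
    by apply/rowP => k; rewrite !mxE /psi mmapC /= mevalXU /pi row_mxEr.
  rewrite -[RHS](hh p x y (equalizing_mx i y G1) (equalizing_mx j x G2^T)^T Yp hx hy).
  - apply: eq_mmap => k /=; first by rewrite /psi mmapC /= mevalC.
    by rewrite mapE psi1 psi2 psiX psiZ.
  - by eexists; apply: mulmx_equalizing_mx.
  - by rewrite trmxK; eexists; apply: mulmx_equalizing_mx.
have theta1 : map_mx theta A1 = generic_payoff1 K d.
  by apply/matrixP => a b; rewrite !mxE /theta mmapX mmap1U.
have theta2 : map_mx theta A2 = generic_payoff2 K d.
  by apply/matrixP => a b; rewrite !mxE /theta mmapX mmap1U.
have thetaX : map_mx theta X = cramer_row (generic_payoff2 K d)^T.
  apply/rowP => k; rewrite 2!mxE /theta mmapC /= /subst /comp_mpoly mmapX mmap1U.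
  by rewrite tnth_mktuple row_mxEl.
have thetaZ : map_mx theta Z = cramer_row (generic_payoff1 K d).
  apply/rowP => k; rewrite 2!mxE /theta mmapC /= /subst /comp_mpoly mmapX mmap1U.
  by rewrite tnth_mktuple row_mxEr.
have -> : mmap (@mpolyC n K)
    (row_mx (mxvec (pibar2 K d 0 i *: generic_payoff1 K d))
            (mxvec (pibar1 K d 0 j *: generic_payoff2 K d)) 0) h = theta P.
  rewrite /theta /subst rmorph_mmap -/subst -/theta; apply: eq_mmap => k /=.
    by rewrite /theta mmapC /= /subst /comp_mpoly mmapC.
  rewrite mapE theta1 theta2 thetaX thetaZ !equalizing_mx_cramer_row.
  have trZ c (M : 'M[S]_d) : (c *: M^T)^T = c *: M.
    by apply/matrixP => a b; rewrite !mxE.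
  rewrite trZ.
  set D1 := det_ones _ _. set D2 := det_ones _ _.
  have -> : D1 = pibar2 K d 0 i by rewrite mxE.
  have -> : D2 = pibar1 K d 0 j by rewrite mxE.
  by [].
rewrite /theta /mmap; apply: ideal_span_sum => m _; rewrite mulrC.
by apply: ideal_spanM; apply: ideal_span_rmorph; rewrite -Yideal; apply: P_coef.
Qed.

Lemma homogeneous_mem_saturation h e1 e2 :
  h \is e1.-homog for (wdeg (block_weight 1 0)) ->
  h \is e2.-homog for (wdeg (block_weight 0 1)) ->
  vanishes_on_equalized h -> saturation Inash B h.
Proof.
move=> h1 h2 hh; apply: (saturation_pigeonhole (ex := e2) (ey := e1)) => j i.
have scale (p1 p2 : S) :
    mmap (@mpolyC n K) (row_mx (mxvec (p2 *: generic_payoff1 K d))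
                               (mxvec (p1 *: generic_payoff2 K d)) 0) h
    = p1 ^+ e2 * p2 ^+ e1 * h.
  set U := mxvec (generic_payoff1 K d); set V := mxvec (generic_payoff2 K d).
  have hE : mmap (@mpolyC n K) (row_mx U V 0) h = h.
    rewrite [RHS]mpolyE; apply: eq_bigr => m _; rewrite mul_mpolyC -mmap1_id.
    congr (_ *: _); apply: mmap1_eq => k.
    exact: (mxvec_block (fun k => 'X_k : S) k).
  rewrite -[in RHS]hE -mulrA -(mmap_homog _ _ _ h1) -(mmap_homog _ _ _ h2).
  apply: eq_mmap => // k.
  by rewrite block_weight_row block_weight_row !expr0 !expr1 !scale1r !linearZ.
by rewrite -scale; apply: equalizing_substitution.
Qed.

Lemma nash_locus_saturation : nash_locus Y = zero_locus (saturation Inash B).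
Proof.
apply/seteqP; split=> g gN.
  apply: gN => [|g']; first by exists (saturation Inash B).
  exact: nash_scheme_saturation.
move=> _ [T ->] XT t Tt u v hu hv.
have ht : vanishes_on_equalized t.
  by apply: vanishes_on_equalizedP => g' /XT; apply.
have [N1 tE] := wcomp_sum (block_weight 1 0) t.
rewrite /bieval tE raddf_sum big1 // => a _ /=.
have [N2 tE2] := wcomp_sum (block_weight 0 1) (wcomp (block_weight 1 0) a t).
rewrite tE2 raddf_sum big1 // => b _ /=.
apply: gN hu hv; apply: (@homogeneous_mem_saturation _ a b).
- exact/wcomp_homog/pihomogP.
- exact: pihomogP.
- by do 2!apply: vanishes_on_equalized_wcomp.
Qed.
End NashLocusEquations.

(** * Totally mixed equilibria *)

Section RealGames.
Variables (R : realType) (d : nat).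
Implicit Types (M : 'M[R]_d) (x y : 'rV[R]_d).

Lemma expected_payoffE M x y :
  expected_payoff M x y = \sum_j x 0 j * (M *m y^T) j 0.
Proof.
apply: eq_bigr => j _; rewrite mxE mulr_sumr; apply: eq_bigr => k _.
by rewrite mxE mulrA (mulrC (M j k)).
Qed.

Lemma expected_payoff_tr M x y : expected_payoff M x y = expected_payoff M^T y x.
Proof.
rewrite /expected_payoff exchange_big; apply: eq_bigr => j _; apply: eq_bigr => k _.
by rewrite mxE mulrAC.
Qed.

(** The payoff v of x is the average of the payoffs of the pure strategies with
    the weights x_j > 0, and none of these exceeds v, so all are equal to v. *)
Lemma totally_mixed_best_response_equalizes M x y :
  simplex x -> (forall j, 0 < x 0 j) ->
  (forall x', simplex x' -> expected_payoff M x' y <= expected_payoff M x y) ->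
  equalizes M y.
Proof.
move=> [_ x1] x_gt0 best; set v := expected_payoff M x y in best *.
have pure j : (M *m y^T) j 0 <= v.
  have /best : simplex (delta_mx 0 j : 'rV[R]_d).
    split=> [k|]; first by rewrite mxE ler0n.
    by rewrite (bigD1 j) //= mxE !eqxx big1 ?addr0 // => k kj; rewrite mxE (negPf kj) andbF.
  rewrite expected_payoffE (bigD1 j) //= mxE !eqxx mul1r big1 ?addr0 // => k kj.
  by rewrite mxE (negPf kj) andbF mul0r.
have sum0 : \sum_j x 0 j * (v - (M *m y^T) j 0) = 0.
  under eq_bigr do rewrite mulrBr; rewrite sumrB -mulr_suml x1 mul1r.
  by rewrite -expected_payoffE subrr.
have term_ge0 j : 0 <= x 0 j * (v - (M *m y^T) j 0).
  by rewrite mulr_ge0 ?subr_ge0 // ltW.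
have vE := psumr_eq0P (fun j _ => term_ge0 j) sum0.
exists v; apply/colP => j; rewrite [RHS]mxE; apply/eqP.
by have /eqP := vE j isT; rewrite mulf_eq0 gt_eqF //= subr_eq0 eq_sym.
Qed.

Lemma equalizes_payoff M x x' y : equalizes M y -> simplex x -> simplex x' ->
  expected_payoff M x' y = expected_payoff M x y.
Proof.
move=> [l Ml] [_ x1] [_ x'1]; rewrite !expected_payoffE Ml.
have E z : \sum_j z 0 j * (const_mx l : 'cV_d) j 0 = (\sum_j z 0 j) * l :> R.
  by rewrite mulr_suml; apply: eq_bigr => j _; rewrite mxE.
by rewrite !E x1 x'1.
Qed.

Lemma equalizing_same_sign M y :
  equalizes M y -> (forall j, 0 < y 0 j) ->
  same_sign (det_ones M) \/ (forall i, det_ones M i = 0).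
Proof.
move=> My y_gt0; have [/existsP[i Di]|] := boolP [exists i, det_ones M i != 0].
  have DE j : det_ones M j = det_ones M i * (y 0 j / y 0 i).
    have /rowP/(_ j) := equalizes_cramer_row Di My; rewrite !mxE => E.
    by rewrite mulrA E mulrC mulKf // gt_eqF.
  left; have [Dneg|Dpos|D0] := ltgtP (det_ones M i) 0; last by rewrite D0 eqxx in Di.
    by right=> j; rewrite DE nmulr_rlt0 // divr_gt0.
  by left=> j; rewrite DE mulr_gt0 // divr_gt0.
rewrite negb_exists => /forallP D0; right=> i; apply/eqP.
by have := D0 i; rewrite negbK.
Qed.

(** Dividing by the sum of the entries produces a probability vector for either
    sign. *)
Lemma same_sign_strategy M : (0 < d)%N -> same_sign (det_ones M) ->
  exists c, let y := c *: cramer_row M in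
    [/\ c != 0, simplex y, forall j, 0 < y 0 j & equalizes M y].
Proof.
move=> d0 hD; set s := \sum_j det_ones M j; exists s^-1 => /=.
have yE j : (s^-1 *: cramer_row M) 0 j = s^-1 * det_ones M j by rewrite !mxE.
have [s0 y_gt0] : s != 0 /\ forall j, 0 < s^-1 * det_ones M j.
  case: hD => hD.
    have s_gt0 : 0 < s.
      rewrite /s (bigD1 (Ordinal d0)) //= ltr_pwDl // sumr_ge0 // => j _.
      by rewrite ltW.
    by split=> [|j]; rewrite ?gt_eqF // mulr_gt0 ?invr_gt0.
  have s_lt0 : s < 0.
    rewrite /s (bigD1 (Ordinal d0)) //= -oppr_gt0 opprD ltr_pwDl ?oppr_gt0 //.
    by rewrite oppr_ge0 sumr_le0 // => j _; rewrite ltW.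
  by split=> [|j]; rewrite ?lt_eqF // nmulr_lgt0 ?invr_lt0.
split=> [||j|]; rewrite ?invr_eq0 ?yE //.
  split=> [j|]; first by rewrite yE ltW.
  by under eq_bigr do rewrite yE; rewrite -mulr_sumr mulVf.
have := equalizesZ 1 s^-1 (ex_intro _ _ (mulmx_cramer_row M)).
by rewrite scale1r.
Qed.

End RealGames.

Section RealNashLocus.
Variables (R : realType) (d s : nat) (Y : set (proj R[i] d * proj R[i] d)).
Variable f : 'I_s -> {mpoly R[i][d + d]}.
Hypothesis Yideal : vanishing_ideal Y = ideal_span (range f).
Implicit Types (G : 'M[R]_d) (x y : 'rV[R]_d).

Local Notation toC := (map_mx (real_complex R)).

Lemma equalizes_complex G x : equalizes G x -> equalizes (toC G) (toC x).
Proof.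
move=> [l Gl]; exists (real_complex R l).
by rewrite matrix.map_trmx -map_mxM Gl map_const_mx.
Qed.

Lemma nash_equilibrium_equalizes G1 G2 x y :
  nash_equilibrium G1 G2 x y -> totally_mixed x y ->
  equalizes G1 y /\ equalizes G2^T x.
Proof.
move=> [sx sy best1 best2] xy_gt0; split.
  by apply: (totally_mixed_best_response_equalizes sx) => // j; case: (xy_gt0 j).
apply: (totally_mixed_best_response_equalizes sy) => [j|y' sy'].
  by case: (xy_gt0 j).
by rewrite -!expected_payoff_tr; apply: best2.
Qed.

Lemma equalizes_nash_equilibrium G1 G2 x y :
  simplex x -> simplex y -> equalizes G1 y -> equalizes G2^T x ->
  nash_equilibrium G1 G2 x y.
Proof.
move=> sx sy G1y G2x; split=> // [x' sx'|y' sy'].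
  by rewrite (equalizes_payoff G1y sx).
by rewrite !(expected_payoff_tr G2) (equalizes_payoff G2x sy).
Qed.

Lemma totally_mixed_nash_locus g G1 G2 :
  is_real_class g G1 G2 -> has_totally_mixed_nash_on G1 G2 Y ->
  [/\ nash_locus Y g,
      same_sign (det_ones G1) \/ (forall i, det_ones G1 i = 0)
    & same_sign (det_ones G2^T) \/ (forall i, det_ones G2^T i = 0)].
Proof.
move=> [hG1 hG2] [x [y [nxy xy_gt0 [p [Yp hx hy]]]]].
have [G1y G2x] := nash_equilibrium_equalizes nxy xy_gt0; split.
- move=> Z _; apply; exists p; split=> //.
  apply/(nash_schemeP hG1 hG2 hx hy); rewrite matrix.map_trmx.
  by split; apply: equalizes_complex.
- by apply: (equalizing_same_sign G1y) => j; case: (xy_gt0 j).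
- by apply: (equalizing_same_sign G2x) => j; case: (xy_gt0 j).
Qed.

Lemma nash_locus_totally_mixed g G1 G2 :
  (0 < d)%N -> zariski_closed Y -> is_real_class g G1 G2 -> nash_locus Y g ->
  same_sign (det_ones G1) -> same_sign (det_ones G2^T) ->
  has_totally_mixed_nash_on G1 G2 Y.
Proof.
move=> d0 Yclosed [hG1 hG2]; rewrite (nash_locus_saturation Yideal) => gN D1 D2.
have [b [b0 sy y_gt0 G1y]] := same_sign_strategy d0 D1.
have [a [a0 sx x_gt0 G2x]] := same_sign_strategy d0 D2.
exists (a *: cramer_row G2^T), (b *: cramer_row G1); split.
- exact: equalizes_nash_equilibrium.
- by [].
have neq0 c M : (forall j, 0 < (c *: cramer_row M) 0 j) ->
    toC (c *: cramer_row M) != 0 :> 'rV_d.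
  move=> M_gt0; rewrite map_mx_eq0; apply/rV0Pn; exists (Ordinal d0).
  by rewrite gt_eqF.
have [p1 hp1] := class_exists (neq0 _ _ x_gt0).
have [p2 hp2] := class_exists (neq0 _ _ y_gt0).
exists (p1, p2); split=> //.
have mapZ c M : toC (c *: cramer_row M) = real_complex R c *: cramer_row (toC M).
  by apply/rowP => j; rewrite !mxE rmorphM map_det_ones.
have unZ (P : proj R[i] d) c M : c != 0 -> is_class P (toC (c *: cramer_row M)) ->
    is_class P (cramer_row (toC M)).
  move=> c0; rewrite mapZ => hP.
  have c0' : real_complex R c != 0 by rewrite fmorph_eq0.
  by rewrite -[cramer_row _](scalerK c0'); apply: is_classZ; rewrite ?invr_eq0.
apply: (mem_subvariety (p := (p1, p2)) Yideal Yclosed (unZ _ _ _ a0 hp1) (unZ _ _ _ b0 hp2)) => k.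
rewrite -matrix.map_trmx -meval_subst_pibar; apply: gN hG1 hG2.
exists 0%N => c _; rewrite mulrC; apply: ideal_spanM.
by apply: ideal_span_sub; exists k.
Qed.

End RealNashLocus.

Theorem proposition3p6 (R : realType) (d : nat) (hd : (2 <= d)%N)
    (Y : set (proj R[i] d * proj R[i] d)) (hY : irreducible_subvariety Y)
    (s : nat) (f : 'I_s -> {mpoly R[i][d + d]})
    (hf : vanishing_ideal Y = ideal_span (range f)) :
  (nash_locus Y =
     zero_locus
       (saturation
          (ideal_span (range (fun k => subst_pibar (f k))))
          (ideal_span (range (fun i => pibar1 R[i] d 0 i)) `&`
           ideal_span (range (fun i => pibar2 R[i] d 0 i)))))
  /\
  (forall (g : proj R[i] (d * d) * proj R[i] (d * d)) (G1 G2 : 'M[R]_d),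
     is_real_class g G1 G2 ->
     [/\ nash_locus Y g ->
         (forall i, 0 < det_ones G1 i /\ 0 < det_ones G2^T i) ->
         has_totally_mixed_nash_on G1 G2 Y,
         (exists i, det_ones G1 i != 0) -> (exists i, det_ones G2^T i != 0) ->
         (has_totally_mixed_nash_on G1 G2 Y <->
          [/\ nash_locus Y g, same_sign (det_ones G1)
            & same_sign (det_ones G2^T)])
       & has_totally_mixed_nash_on G1 G2 Y ->
         [/\ nash_locus Y g,
             same_sign (det_ones G1) \/ (forall i, det_ones G1 i = 0)
           & same_sign (det_ones G2^T) \/ (forall i, det_ones G2^T i = 0)]]).
Proof.
have [Yclosed _ _] := hY; have d0 : (0 < d)%N by apply: ltnW.
split=> [|g G1 G2 hg]; first exact: nash_locus_saturation.
split=> [gN D_gt0|[i Di] [j Dj]|]; last exact: totally_mixed_nash_locus.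
  by apply: (nash_locus_totally_mixed hf d0 Yclosed hg gN); left=> i; case: (D_gt0 i).
split=> [/(totally_mixed_nash_locus hg)[gN D1 D2]|[gN D1 D2]]; last first.
  exact: (nash_locus_totally_mixed hf d0 Yclosed hg gN).
split=> //.
  by case: D1 => // D1; rewrite D1 eqxx in Di.
by case: D2 => // D2; rewrite D2 eqxx in Dj.
Qed.
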